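(* For a fixed $\beta\in\mathbb R^p$, let $$W_n(\beta,x)=\int\Big(e^{\beta'z}\int_0^x\{u\ge s\}\,ds\Big)\,d\mathbb P_n(u,\delta,z),\qquad Y_n(x)=\int\delta\{u\le x\}\,d\mathbb P_n(u,\delta,z),\qquad x\ge0.$$ Then the nonparametric maximum likelihood estimator (NPMLE) $\hat\lambda_n(x;\beta)$ of a nonincreasing baseline hazard function $\lambda_0$ (as defined in the context) is given by $$\hat\lambda_n(x;\beta)=\hat\lambda_i\qquad\text{for }x\in(T_{(i-1)},T_{(i)}],\quad i=1,2,\dots,n,$$ where $T_{(0)}=0$ and $\hat\lambda_i$ is the left derivative of the least concave majorant at the point $P_i$ of the cumulative sum diagram consisting of the points $$P_j=\Big(W_n(\beta,T_{(j)}),\,Y_n(T_{(j)})\Big),\qquad j=1,2,\dots,n,$$ and $P_0=(0,0)$. Furthermore, for $i=1,2,\dots,n$, $$\hat\lambda_i=\min_{1\le s\le i}\ \max_{i\le t\le n}\frac{\sum_{j=s}^t\Delta_{(j)}}{\sum_{j=s}^t\big(T_{(j)}-T_{(j-1)}\big)\sum_{l=j}^n e^{\beta'Z_{(l)}}}.$$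
   Context: Data: $(T_i,\Delta_i,Z_i)$, $i=1,\dots,n$, with follow-up times $T_i> 0$, censoring indicators $\Delta_i\in\{0,1\}$ and covariates $Z_i\in\mathbb R^p$, from the Cox model with conditional hazard $\lambda_0(x)e^{\beta_0'z}$ given $Z=z$. $T_{(1)}<T_{(2)}<\dots<T_{(n)}$ are the ordered (distinct) follow-up times, and $\Delta_{(i)},Z_{(i)}$ are the censoring indicator and covariate corresponding to $T_{(i)}$. $\mathbb P_n$ is the empirical measure of the $(T_i,\Delta_i,Z_i)$, and $\{\cdot\}$ denotes an indicator. The NPMLE of a nonincreasing baseline hazard, for $\beta$ fixed, is the maximizer, over all nonincreasing $\lambda_0\ge0$, of the (pseudo) loglikelihood $$\sum_{i=1}^n\Big[\Delta_i\log\lambda_0(T_i)+\Delta_i\beta'Z_i-e^{\beta'Z_i}\Lambda_0(T_i)\Big],\qquad \Lambda_0(x)=\int_0^x\lambda_0(u)\,du.$$ For $x>T_{(n)}$ the likelihood does not determine the estimator, and any value not larger than $\hat\lambda_n(T_{(n)};\beta)$ may be chosen there. *)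

(* Defs.v *)
From HB Require Import structures.
From mathcomp Require Import all_boot all_order all_algebra.
From mathcomp Require Import all_classical all_reals all_analysis.
Set Implicit Arguments.
Unset Strict Implicit.
Unset Printing Implicit Defensive.
Import Order.TTheory GRing.Theory Num.Theory.
Import numFieldNormedType.Exports.
Local Open Scope classical_set_scope.
Local Open Scope ring_scope.

(* Vectors of R^p are p.-tuples, which carry the product sigma-algebra. *)
Definition dotp (R : realType) (p : nat) (b z : p.-tuple R) : R :=
  \sum_(k < p) tnth b k * tnth z k.

Definition empirical (d : measure_display) (O : measurableType d)
    (R : realType) (n : nat) (X : 'I_n -> O) (A : set O) : \bar R :=
  ((n%:R^-1 : R)%:E * \sum_(i < n) \d_(X i) A)%E.

Section empirical_measure.
Context (d : measure_display) (O : measurableType d) (R : realType).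
Context (n : nat) (X : 'I_n -> O).

Let m (k : nat) : {measure set O -> \bar R} :=
  if insub k is Some i then \d_(X (i : 'I_n)) else mzero.

Let empiricalE : empirical R X = mscale (n%:R^-1)%:nng (msum m n).
Proof.
apply/funext => A; rewrite /empirical /mscale /msum; congr (_ * _)%E.
by apply: eq_bigr => i _; rewrite /m valK.
Qed.

Let empirical0 : empirical R X set0 = 0%E.
Proof. by rewrite empiricalE measure0. Qed.

Let empirical_ge0 A : (0 <= empirical R X A)%E.
Proof. by rewrite empiricalE measure_ge0. Qed.

Let empirical_sigma_additive : semi_sigma_additive (empirical R X).
Proof. by rewrite empiricalE; exact: measure_semi_sigma_additive. Qed.

HB.instance Definition _ := isMeasure.Build d O R (empirical R X)
  empirical0 empirical_ge0 empirical_sigma_additive.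

End empirical_measure.

Section data.
Context (R : realType) (p n : nat).
Context (T : 'I_n -> R) (Delta : 'I_n -> bool) (Z : 'I_n -> p.-tuple R).

Definition obs (i : 'I_n) : R * bool * p.-tuple R := (T i, Delta i, Z i).

(* Indices of the observations, by increasing follow-up time. *)
Definition ranking : seq 'I_n := sort (fun i j => T i <= T j) (enum 'I_n).

(* T_(j), Delta_(j), Z_(j), with 1-based j and T_(0) = 0; the heads of the
   lists for Delta and Z are dummies. *)
Definition Tord (j : nat) : R := nth 0 (0 :: map T ranking) j.
Definition Dord (j : nat) : bool := nth false (false :: map Delta ranking) j.
Definition Zord (j : nat) : p.-tuple R :=
  let z0 := [tuple 0 | k < p] in nth z0 (z0 :: map Z ranking) j.

Definition Wn (beta : p.-tuple R) (x : R) : R :=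
  \int[empirical R obs]_o
    (expR (dotp beta o.2) *
     \int[@lebesgue_measure R]_(s in `[0, x]) (s <= o.1.1)%R%:R).

Definition Yn (x : R) : R :=
  \int[empirical R obs]_o (o.1.2%:R * (o.1.1 <= x)%R%:R).

Definition cusum (beta : p.-tuple R) (j : nat) : R * R :=
  if j is 0 then (0, 0) else (Wn beta (Tord j), Yn (Tord j)).

(* Only the values of lam on ]0, +oo[ matter. *)
Definition nonincreasing_hazard (lam : R -> R) : Prop :=
  (forall x, 0 < x -> 0 <= lam x) /\
  (forall x y, 0 < x -> x <= y -> lam y <= lam x).

(* Extended-real valued, since lam may be non-integrable at 0. *)
Definition cumhaz (lam : R -> R) (x : R) : \bar R :=
  (\int[@lebesgue_measure R]_(u in `]0%R, x]) (lam u)%:E)%E.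

(* lne 0 = -oo and 0 * -oo = 0, so that only uncensored observations with a
   zero hazard (or an infinite cumulative hazard) give the value -oo. *)
Definition loglik (beta : p.-tuple R) (lam : R -> R) : \bar R :=
  (\sum_(i < n)
     ((Delta i)%:R%:E * lne (lam (T i))%:E
      + ((Delta i)%:R * dotp beta (Z i))%:E
      - (expR (dotp beta (Z i)))%:E * cumhaz lam (T i)))%E.

Definition is_npmle (beta : p.-tuple R) (lam : R -> R) : Prop :=
  nonincreasing_hazard lam /\
  forall mu, nonincreasing_hazard mu ->
    (loglik beta mu <= loglik beta lam)%E.

(* sum_{j=s}^t Delta_(j)
   / sum_{j=s}^t (T_(j) - T_(j-1)) sum_{l=j}^n exp(beta'Z_(l)) *)
Definition block_ratio (beta : p.-tuple R) (s t : nat) : R :=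
  (\sum_(s <= j < t.+1) (Dord j)%:R) /
  (\sum_(s <= j < t.+1) (Tord j - Tord j.-1) *
     \sum_(j <= l < n.+1) expR (dotp beta (Zord l))).

(* The default value of each iterated min/max is one of its terms, hence
   neutral. *)
Definition max_ratio (beta : p.-tuple R) (i s : nat) : R :=
  \big[Num.max/block_ratio beta s i]_(i <= t < n.+1) block_ratio beta s t.
Definition minmax_ratio (beta : p.-tuple R) (i : nat) : R :=
  \big[Num.min/max_ratio beta i i]_(1 <= s < i.+1) max_ratio beta i s.

End data.

Definition concave_on (R : realType) (c : R) (g : R -> R) : Prop :=
  convex_function (`[0, c]%classic : set R) (fun w => - g w).

(* Concave majorant, on [0, (P n).1], of the points P 0, ..., P n. *)
Definition concave_majorant (R : realType) (n : nat) (P : nat -> R * R)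
    (g : R -> R) : Prop :=
  concave_on (P n).1 g /\ forall j, (j <= n)%N -> (P j).2 <= g (P j).1.

Definition least_concave_majorant (R : realType) (n : nat) (P : nat -> R * R)
    (g : R -> R) : Prop :=
  concave_majorant n P g /\
  forall h, concave_majorant n P h ->
    forall w, 0 <= w <= (P n).1 -> g w <= h w.

Definition is_left_derivative (R : realType) (g : R -> R) (w l : R) : Prop :=
  (g y - g w) / (y - w) @[y --> w^'-] --> l.

(* Main.v *)
(* Replacing a nonincreasing hazard by the left-continuous step function with
   the same values at the follow-up times can only decrease the cumulative
   hazard, and does so strictly unless the hazard already is that step
   function. On step functions with values m_k the loglikelihood is, up to a
   constant, n times
     sum_k ((Y_k - Y_(k-1)) ln m_k - m_k (W_k - W_(k-1))),
   with (W_k, Y_k) the vertices of the cumulative sum diagram.  If lam_k are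
   the slopes and M_k the vertex values of the least concave majorant, then
   ln x <= x - 1 at x = m_k / lam_k and a summation by parts against
   Y_k - M_k <= 0, which vanishes wherever lam drops, show that m = lam is the
   unique maximizer. The min-max formula follows by comparing chords of the
   diagram with the linear piece of the majorant that contains P_i. *)

Require Import Defs.
From mathcomp Require Import all_boot all_order all_algebra.
From mathcomp Require Import all_classical all_reals all_analysis.
From mathcomp Require Import measurable_realfun.
From mathcomp Require Import zify ring lra.
Import Order.TTheory GRing.Theory Num.Theory.
Import numFieldNormedType.Exports.
Local Open Scope classical_set_scope.
Local Open Scope ring_scope.

Set Implicit Arguments.
Unset Strict Implicit.
Unset Printing Implicit Defensive.

(** * Least concave majorant of a cumulative sum diagram *)

(* M k is the height of the majorant over W k, and lam k its slope between
   W k.-1 and W k; u and v in lcm_contact are vertices of the diagram through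
   which the linear piece carrying the i-th edge passes. *)
Record lcm_vertices (R : realType) (a n : nat) (W Y lam M : nat -> R) : Prop :=
  LcmVertices {
    lcmS : forall k, (a <= k < n)%N ->
      M k.+1 = M k + lam k.+1 * (W k.+1 - W k);
    lcm_ge : forall k, (a <= k <= n)%N -> Y k <= M k;
    lcm_nonincr : forall i j, (a < i)%N -> (i <= j <= n)%N -> lam j <= lam i;
    lcm_contact : forall i, (a < i <= n)%N -> exists u v,
      [/\ (a <= u < i)%N, (i <= v <= n)%N, M u = Y u, M v = Y v &
          forall j, (u < j <= v)%N -> lam j = lam i] }.

Lemma ltn_incr_lt (R : realType) (n : nat) (W : nat -> R) :
  (forall k, (k < n)%N -> W k < W k.+1) ->
  forall i j, (i < j)%N -> (j <= n)%N -> W i < W j.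
Proof.
move=> W_incr i; elim=> // j IHj; rewrite ltnS leq_eqVlt => /orP[/eqP<-|ij] jn.
  exact: W_incr.
by apply: (lt_trans (IHj ij (ltnW jn))); exact: W_incr.
Qed.

Section lcm_existence.
Context (R : realType) (n : nat) (W Y : nat -> R).
Hypothesis W_incr : forall k, (k < n)%N -> W k < W k.+1.

Let W_lt := ltn_incr_lt W_incr.

Let slope (a k : nat) := (Y k - Y a) / (W k - W a).

(* From a, the majorant follows the chord of largest slope, up to the far end
   t of that chord, and continues from there. *)
Lemma lcm_vertices_from (a : nat) : (a <= n)%N ->
  exists lam M, [/\ lcm_vertices a n W Y lam M, M a = Y a &
    forall c, (forall k, (a < k <= n)%N -> Y k - Y a <= c * (W k - W a)) ->
      forall j, (a < j <= n)%N -> lam j <= c].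
Proof.
move: {-1}(n - a)%N (leqnn (n - a)) => m; elim: m a => [|m IHm] a.
  rewrite leqn0 subn_eq0 => na an.
  have {na an} -> : a = n by apply/eqP; rewrite eqn_leq an.
  exists (fun=> 0), Y; split=> // [|c _ j]; last by lia.
  split=> [k|k kn|i j|i]; [lia| |lia|lia].
  exact: lexx.
rewrite leq_eqVlt => /orP[/eqP na _|]; last by rewrite ltnS => /IHm.
have an : (a < n)%N by lia.
have [t /andP[at_ tn] tmax] : exists2 t, (a < t <= n)%N &
    forall k, (a < k <= n)%N -> slope a k <= slope a t.
  pose P (k : 'I_n.+1) := (a < k)%N.
  have Pn : P ord_max by [].
  case: (arg_maxP (fun k : 'I_n.+1 => slope a k) Pn) => t Pt tmax.
  exists t; first by apply/andP; split; [exact: Pt|rewrite -ltnS ltn_ord].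
  by move=> k /andP[ak kn]; apply: (tmax (Ordinal (kn : (k < n.+1)%N))).
have [lam' [M' [[M'S M'ge lam'_ni M'c] M't lam'_le]]] :
  exists lam M, [/\ lcm_vertices t n W Y lam M, M t = Y t &
    forall c, (forall k, (t < k <= n)%N -> Y k - Y t <= c * (W k - W t)) ->
      forall j, (t < j <= n)%N -> lam j <= c] by apply: IHm; lia.
pose rho := slope a t.
have Yt : Y t - Y a = rho * (W t - W a).
  by rewrite divfK// subr_eq0 gt_eqF// W_lt.
have Yk k : (a < k <= n)%N -> Y k - Y a <= rho * (W k - W a).
  move=> /andP[ak kn]; rewrite -ler_pdivrMr ?subr_gt0 ?W_lt//.
  by rewrite tmax// ak.
(* A chord leaving [t] more steeply than [rho] would contradict the maximality of the chord from [a]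
   to [t]. This keeps the slopes nonincreasing across [t]. *)
have lam'_le_rho j : (t < j <= n)%N -> lam' j <= rho.
  apply: lam'_le => k /andP[tk kn].
  have ak : (a < k <= n)%N by lia.
  by have := Yk k ak; nra.
exists (fun j => if (j <= t)%N then rho else lam' j).
exists (fun k => if (k <= t)%N then Y a + rho * (W k - W a) else M' k).
split; [split| |].
- move=> k /andP[ak kn]; case: ltngtP => kt; first 1 last.
  + by rewrite M'S//; lia.
  + rewrite kt M'S ?leqnn//= ?M't; last by lia.
    lra.
  + by ring.
- move=> k /andP[]; rewrite leq_eqVlt => /orP[/eqP<-|ak] kn.
    by rewrite (ltnW at_) subrr mulr0 addr0.
  case: leqP => kt; first by rewrite -lerBlDl Yk// ak.
  by rewrite M'ge// (ltnW kt).
- move=> i j ai /andP[ij jn]; case: leqP => jt.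
    by rewrite (leq_trans ij jt).
  case: leqP => it; first by rewrite lam'_le_rho// jt.
  by rewrite lam'_ni// ij.
- move=> i /andP[ai in_]; case: leqP => it.
    exists a, t; rewrite leqnn ai it tn (ltnW at_) leqnn subrr mulr0 addr0 /=.
    split=> //; first by rewrite -Yt addrC subrK.
    by move=> j /andP[_ ->].
  have [|u [v [/andP[tu ui] iv Mu Mv lamuv]]] := M'c i; first by rewrite it.
  exists u, v; split=> //.
  + by rewrite ui (ltnW (leq_trans at_ tu)).
  (* If [u = t], the height is read off the chord, which ends at [Y t]. *)
  + move: tu; rewrite leq_eqVlt => /orP[/eqP <-|tu].
      by rewrite leqnn -Yt addrC subrK.
    by rewrite leqNgt tu.
  + by rewrite ifF//; lia.
  + move=> j uj; rewrite ifF; last by lia.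
    exact: lamuv.
- by rewrite (ltnW at_) subrr mulr0 addr0.
- move=> c Hc j /andP[aj jn].
  have rhoc : rho <= c.
    rewrite /rho /slope ler_pdivrMr ?subr_gt0 ?W_lt//.
    by rewrite Hc// at_.
  by case: leqP => jt//; rewrite (le_trans (lam'_le_rho _ _)) ?jt.
Qed.

Lemma lcm_vertices_exists : exists lam M,
  lcm_vertices 0 n W Y lam M /\ M 0%N = Y 0%N.
Proof.
have [lam [M [lamM M0 _]]] := lcm_vertices_from (leq0n n).
by exists lam, M.
Qed.

End lcm_existence.

(** Trades the bundled weights of [convex_function] for a plain real weight. *)
Lemma concave_onP (R : realType) (c : R) (g : R -> R) :
  concave_on c g <->
  forall t x y, 0 <= t <= 1 -> 0 <= x <= c -> 0 <= y <= c ->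
    t * g x + (1 - t) * g y <= g (t * x + (1 - t) * y).
Proof.
split=> [cg t x y /andP[t0 t1] x0c y0c|cg t x y].
  have := cg (Itv01 t0 t1) x y; rewrite !inE/= !in_itv/= => /(_ x0c y0c).
  rewrite !convRE/= /unstable.onem => h; rewrite -lerN2 (le_trans h)//.
  by rewrite le_eqVlt; apply/orP; left; apply/eqP; ring.
rewrite !inE/= !in_itv/= => x0c y0c; rewrite !convRE/= /unstable.onem.
have t01 : 0 <= (t%:inum : R) <= 1 by apply/andP; split.
have := cg (t%:inum : R) x y t01 x0c y0c; rewrite -lerN2 => /le_trans; apply.
by rewrite le_eqVlt; apply/orP; left; apply/eqP; ring.
Qed.

Section lcm_properties.
Context (R : realType) (n : nat) (W Y lam M : nat -> R).
Hypothesis W_incr : forall k, (k < n)%N -> W k < W k.+1.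
Hypothesis lamM : lcm_vertices 0 n W Y lam M.

Let W_lt := ltn_incr_lt W_incr.

Let W_le i j : (i <= j <= n)%N -> W i <= W j.
Proof.
by rewrite leq_eqVlt => /andP[/orP[/eqP->//|ij] jn]; rewrite ltW// W_lt.
Qed.

Lemma lcm_vertices_le (c : R) (i j : nat) : (i <= j <= n)%N ->
  (forall k, (i < k <= j)%N -> lam k <= c) -> M j - M i <= c * (W j - W i).
Proof.
elim: j => [|j IHj]; first by rewrite leqn0 => /andP[/eqP-> _]; lra.
rewrite leq_eqVlt => /andP[/orP[/eqP->|ij] jn] lamc; first lra.
have {}IHj : M j - M i <= c * (W j - W i).
  by apply: IHj => [|k ikj]; [lia|apply: lamc; lia].
rewrite (lcmS lamM)//.
have := lamc j.+1; rewrite ij leqnn => /(_ isT) lamjc.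
have := W_incr jn; nra.
Qed.

Lemma lcm_vertices_ge (c : R) (i j : nat) : (i <= j <= n)%N ->
  (forall k, (i < k <= j)%N -> c <= lam k) -> c * (W j - W i) <= M j - M i.
Proof.
elim: j => [|j IHj]; first by rewrite leqn0 => /andP[/eqP-> _]; lra.
rewrite leq_eqVlt => /andP[/orP[/eqP->|ij] jn] lamc; first lra.
have {}IHj : c * (W j - W i) <= M j - M i.
  by apply: IHj => [|k ikj]; [lia|apply: lamc; lia].
rewrite (lcmS lamM)//.
have := lamc j.+1; rewrite ij leqnn => /(_ isT) lamjc.
have := W_incr jn; nra.
Qed.

Lemma lcm_vertices_cst (c : R) (i j : nat) : (i <= j <= n)%N ->
  (forall k, (i < k <= j)%N -> lam k = c) -> M j - M i = c * (W j - W i).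
Proof.
move=> ijn lamc; apply/eqP; rewrite eq_le.
by rewrite lcm_vertices_le ?lcm_vertices_ge// => k /lamc ->.
Qed.

(** One half of the min-max formula. Take for [s.-1] the left contact vertex [u]: there [M u = Y u],
    all later slopes are at most [lam i], and [Y <= M]. *)
Lemma lcm_slope_le_chord (i : nat) : (0 < i <= n)%N ->
  exists2 s, (0 < s <= i)%N & forall t, (i <= t <= n)%N ->
    Y t - Y s.-1 <= lam i * (W t - W s.-1).
Proof.
move=> in_; have [u [v [ui iv Mu _ lamuv]]] := lcm_contact lamM in_.
exists u.+1 => [|t itn]; first by lia.
have tn : (0 <= t <= n)%N by lia.
rewrite succnK -Mu (le_trans _ (@lcm_vertices_le (lam i) u t _ _))//; last 2 first.
- lia.
- move=> k ukt; case: (leqP k v) => kv; first by rewrite lamuv//; lia.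
  by rewrite (lcm_nonincr lamM)//; lia.
by rewrite lerD2r (lcm_ge lamM).
Qed.

(** The mirror image, with [t] the right contact vertex [v], before which all slopes are at least
    [lam i]. *)
Lemma lcm_chord_le_slope (i : nat) : (0 < i <= n)%N ->
  exists2 t, (i <= t <= n)%N & forall s, (0 < s <= i)%N ->
    lam i * (W t - W s.-1) <= Y t - Y s.-1.
Proof.
move=> in_; have [u [v [ui iv _ Mv lamuv]]] := lcm_contact lamM in_.
exists v => // s si; rewrite -Mv.
have sn : (0 <= s.-1 <= n)%N by lia.
rewrite (le_trans (@lcm_vertices_ge (lam i) s.-1 v _ _))//.
- lia.
- move=> k skv; case: (leqP k i) => ki; last by rewrite lamuv//; lia.
  by rewrite (lcm_nonincr lamM)//; lia.
by rewrite lerD2l lerN2 (lcm_ge lamM).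
Qed.

Let line (i : nat) (w : R) := M i + lam i * (w - W i).

Definition lcm_fun (w : R) : R :=
  \big[Num.min/line 1 w]_(1 <= i < n.+1) line i w.

Hypothesis n_gt0 : (0 < n)%N.

Let lcm_fun_le_line i w : (0 < i <= n)%N -> lcm_fun w <= line i w.
Proof. by move=> in_; rewrite /lcm_fun ge_bigmin_seq// mem_index_iota ltnS. Qed.

Let le_lcm_fun x w : (forall i, (0 < i <= n)%N -> x <= line i w) ->
  x <= lcm_fun w.
Proof.
move=> xline; rewrite /lcm_fun big_nat; apply: le_bigmin; first exact: xline.
by move=> i; rewrite ltnS; exact: xline.
Qed.

Let line_ge i k : (0 < i <= n)%N -> (k <= n)%N -> M k <= line i (W k).
Proof.
move=> in_ kn; rewrite /line; case: (leqP i k) => ik.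
  have := @lcm_vertices_le (lam i) i k; rewrite ik kn => /(_ isT) h.
  suff : M k - M i <= lam i * (W k - W i) by lra.
  by apply: h => j ijk; rewrite (lcm_nonincr lamM)//; lia.
have ki : (k <= i <= n)%N by lia.
have := @lcm_vertices_ge (lam i) k i ki => h.
suff : lam i * (W i - W k) <= M i - M k by lra.
by apply: h => j ijk; rewrite (lcm_nonincr lamM)//; lia.
Qed.

(** At both ends of the edge every [line l] is at least [M], which [line i] attains there; affinity
    extends this to the whole edge. *)
Let lcm_fun_piece i w : (0 < i <= n)%N -> W i.-1 <= w <= W i ->
  lcm_fun w = line i w.
Proof.
move=> in_ /andP[wl wr]; apply/eqP; rewrite eq_le lcm_fun_le_line//=.
apply: le_lcm_fun => l ln.
have i1n : (i.-1 < n)%N by lia.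
have i1 : i.-1.+1 = i by lia.
move: (W_incr i1n) (lcmS lamM i1n); rewrite i1 => Wi Mi.
have := @line_ge l i ln; have := @line_ge l i.-1 ln; rewrite /line.
move=> /(_ (ltnW i1n)) h1 /(_ (proj2 (andP in_))) h2.
(* The inequalities at the two ends, each weighted by the distance of [w] to the other end, add up
   to the claim times the edge length. *)
have {}h2 : 0 <= (w - W i.-1) * (M l + lam l * (W i - W l) - M i).
  by rewrite mulr_ge0 ?subr_ge0.
have {}h1 : 0 <= (W i - w) * (M l + lam l * (W i.-1 - W l) - M i.-1).
  by rewrite mulr_ge0 ?subr_ge0.
rewrite -subr_ge0 -(pmulr_rge0 _ (_ : 0 < W i - W i.-1)) ?subr_gt0//.
apply: le_trans (addr_ge0 h1 h2) _; rewrite le_eqVlt; apply/orP; left.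
have Mi1 : M i.-1 = M i - lam i * (W i - W i.-1) by lra.
by rewrite Mi1; apply/eqP; ring.
Qed.

Lemma lcm_fun_left_derivative (i : nat) : (0 < i <= n)%N ->
  is_left_derivative lcm_fun (W i) (lam i).
Proof.
move=> in_; have Wi : W i.-1 < W i by apply: W_lt; lia.
rewrite /is_left_derivative; apply: cvg_near_cst; near=> y.
have yWi : y < W i by near: y; exact: nbhs_left_lt.
have Wiy : W i.-1 < y by near: y; exact: nbhs_left_gt.
rewrite !(@lcm_fun_piece i)// ?lexx ?ltW//.
rewrite /line; apply/eqP.
have yW : y - W i != 0 by rewrite subr_eq0 lt_eqF.
by rewrite eq_sym; apply/eqP; field.
Unshelve. all: by end_near. Qed.

Let W_bracket k w : (0 < k <= n)%N -> W 0%N <= w <= W k ->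
  exists2 i, (0 < i <= n)%N & W i.-1 <= w <= W i.
Proof.
elim: k => // k IHk kn /andP[w0 wk]; case: (leP (W k) w) => kw.
  by exists k.+1 => //=; rewrite kw.
case: (posnP k) => k0; first by move: kw w0; rewrite k0; lra.
apply: IHk; first by lia.
by rewrite w0 ltW.
Qed.

Lemma lcm_fun_lcm (P : nat -> R * R) : W 0%N = 0 ->
  (forall k, (k <= n)%N -> P k = (W k, Y k)) ->
  least_concave_majorant n P lcm_fun.
Proof.
move=> W0 PE; rewrite /least_concave_majorant /concave_majorant PE//=.
split; [split|] => [|j jn|h [/concave_onP hconc hP] w w0n].
- apply/concave_onP => t x y /andP[t0 t1] _ _; apply: le_lcm_fun => i in_.
  have := lcm_fun_le_line x in_; have := lcm_fun_le_line y in_.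
  rewrite /line; nra.
- rewrite PE//=; apply: le_lcm_fun => i in_.
  by apply: le_trans (line_ge in_ jn); rewrite (lcm_ge lamM).
(* Leastness: [w] lies between contact vertices [W u] and [W v], where [h] is at least [M]; between
   them [M] is interpolated linearly and [h] is concave. *)
- have [i in_ wi] : exists2 i, (0 < i <= n)%N & W i.-1 <= w <= W i.
    by apply: (@W_bracket n); rewrite ?n_gt0 ?leqnn// W0.
  have [u [v [ui iv Mu Mv lamuv]]] := lcm_contact lamM in_.
  rewrite (le_trans (lcm_fun_le_line w in_))// /line.
  have [uin uvn] : (u <= i <= n)%N /\ (u <= v <= n)%N by lia.
  have lamui k : (u < k <= i)%N -> lam k = lam i.
    by move=> uki; apply: lamuv; lia.
  have uvW : W u < W v by apply: W_lt; lia.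
  have [un vn] : (u <= n)%N /\ (v <= n)%N by lia.
  have Wuw : W u <= w.
    by rewrite (le_trans _ (proj1 (andP wi)))// W_le//; lia.
  have Wvw : w <= W v.
    by rewrite (le_trans (proj2 (andP wi)))// W_le//; lia.
  have Wu0 : 0 <= W u by rewrite -W0 W_le//; lia.
  have Wvn : W v <= W n by apply: W_le; lia.
  have hu : M u <= h (W u) by have := hP u un; rewrite PE//= Mu.
  have hv : M v <= h (W v) by have := hP v vn; rewrite PE//= Mv.
  have Mi : M i - M u = lam i * (W i - W u).
    exact: lcm_vertices_cst.
  have Mvu : M v - M u = lam i * (W v - W u).
    exact: lcm_vertices_cst.
  have Wvu : W v - W u != 0 by rewrite subr_eq0 gt_eqF.
  pose t := (W v - w) / (W v - W u).
  have t01 : 0 <= t <= 1.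
    by rewrite ler_pdivlMr ?ler_pdivrMr ?subr_gt0//; apply/andP; split; lra.
  have wE : t * W u + (1 - t) * W v = w by rewrite /t; field.
  have un0 : 0 <= W u <= W n by rewrite Wu0 (le_trans (ltW uvW)).
  have vn0 : 0 <= W v <= W n by rewrite Wvn (le_trans Wu0 (ltW uvW)).
  rewrite -{2}wE (le_trans _ (hconc t (W u) (W v) t01 un0 vn0))//.
  have -> : M i + lam i * (w - W i) = t * M u + (1 - t) * M v.
    have -> : M i = M u + lam i * (W i - W u) by lra.
    have -> : M v = M u + lam i * (W v - W u) by lra.
    by rewrite -wE; ring.
  move: t01 => /andP[t0 t1]; rewrite lerD// ler_wpM2l//; lra.
Qed.

End lcm_properties.

(** * Maximization over step hazards *)

(** This is [1 + y <= expR y] at [y = ln x], strict for nonzero [y]. The equality case serves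
    uniqueness. *)
Lemma ln_leB1_eq (R : realType) (x : R) : 0 < x ->
  ln x <= x - 1 /\ (ln x = x - 1 -> x = 1).
Proof.
move=> x0; have lnxK : expR (ln x) = x by rewrite lnK.
split; first by have := expR_ge1Dx (ln x); rewrite lnxK; lra.
move=> lnx; apply/eqP; apply: contraT => x1.
have lnx0 : ln x != 0 by rewrite lnx subr_eq0.
by have := expR_gt1Dx lnx0; rewrite lnxK lnx addrC subrK ltxx.
Qed.

Section weighted_likelihood.
Context (R : realType) (n : nat) (W Y lam M : nat -> R).
Hypothesis W_incr : forall k, (k < n)%N -> W k < W k.+1.
Hypothesis Y_ndecr : forall k, (k < n)%N -> Y k <= Y k.+1.
Hypothesis lamM : lcm_vertices 0 n W Y lam M.
Hypothesis M0 : M 0%N = Y 0%N.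

Definition weighted_loglik (m : nat -> R) : R :=
  \sum_(k < n) ((Y k.+1 - Y k) * ln (m k.+1) - m k.+1 * (W k.+1 - W k)).

Let W_lt := ltn_incr_lt W_incr.

Let Y_le i j : (i <= j <= n)%N -> Y i <= Y j.
Proof.
elim: j => [|j IHj]; first by rewrite leqn0 => /andP[/eqP->].
rewrite leq_eqVlt => /andP[/orP[/eqP->//|ij] jn].
by apply: le_trans (Y_ndecr jn); apply: IHj; lia.
Qed.

Lemma lcm_slope_ge0 i : (0 < i <= n)%N -> 0 <= lam i.
Proof.
move=> in_; have [u [v [ui iv Mu Mv lamuv]]] := lcm_contact lamM in_.
have uvn : (u <= v <= n)%N by lia.
have Wuv : W u < W v by apply: W_lt; lia.
have := lcm_vertices_cst W_incr lamM uvn lamuv.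
have := Y_le uvn; rewrite Mu Mv; nra.
Qed.

(** The rise of [Y] across edge [i] is part of its rise between the contact vertices. Hence [ln] is
    taken at a positive slope wherever its weight is positive. *)
Lemma lcm_slope_gt0 i : (0 < i <= n)%N -> Y i.-1 < Y i -> 0 < lam i.
Proof.
move=> in_ Yi; have [u [v [ui iv Mu Mv lamuv]]] := lcm_contact lamM in_.
have uvn : (u <= v <= n)%N by lia.
have [uin ivn] : (u <= i.-1 <= n)%N /\ (i <= v <= n)%N by lia.
have Wuv : W u < W v by apply: W_lt; lia.
have := lcm_vertices_cst W_incr lamM uvn lamuv.
have := Y_le uin; have := Y_le ivn; rewrite Mu Mv; nra.
Qed.

Let C k := Y k - M k.

Let C_le0 k : (k <= n)%N -> C k <= 0.
Proof. by move=> kn; rewrite /C subr_le0 (lcm_ge lamM). Qed.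

Let C0 : C 0%N = 0. Proof. by rewrite /C M0 subrr. Qed.

(** A vertex strictly below the majorant cannot be the right contact vertex of its piece, so the
    piece continues past it. *)
Let C_lt0 k : (0 < k <= n)%N -> C k < 0 -> (k < n)%N /\ lam k.+1 = lam k.
Proof.
move=> kn Ck; have [u [v [uk kv Mu Mv lamuv]]] := lcm_contact lamM kn.
have kv' : k != v.
  by apply: contraTneq Ck => ->; rewrite /C Mv subrr ltxx.
by split; [lia|apply: lamuv; lia].
Qed.

Let CS k : (k < n)%N ->
  C k.+1 - C k = Y k.+1 - Y k - lam k.+1 * (W k.+1 - W k).
Proof. by move=> kn; rewrite /C (lcmS lamM)//; ring. Qed.

Variable m : nat -> R.
Hypothesis m_ge0 : forall k, (0 < k <= n)%N -> 0 <= m k.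
Hypothesis m_gt0 : forall k, (0 < k <= n)%N -> Y k.-1 < Y k -> 0 < m k.
Hypothesis m_nincr : forall k, (0 < k < n)%N -> m k.+1 <= m k.

Let q k := m k / lam k - 1.
Let e k := C k * (q k.+1 - q k).
Let g k := q k.+1 * (C k.+1 - C k) -
  ((Y k.+1 - Y k) * ln (m k.+1) - m k.+1 * (W k.+1 - W k) -
   ((Y k.+1 - Y k) * ln (lam k.+1) - lam k.+1 * (W k.+1 - W k))).

(** Either [C k = 0], or [lam] does not change at [k] and [q] inherits the monotonicity of [m]. *)
Let e_ge0 k : (k < n)%N -> 0 <= e k.
Proof.
move=> kn; rewrite /e; case: (posnP k) => [->|k0]; first by rewrite C0 mul0r.
have := C_le0 (ltnW kn); rewrite le_eqVlt => /orP[/eqP->|Ck].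
  by rewrite mul0r.
have [|_ lamk] := C_lt0 _ Ck; first by lia.
rewrite mulr_le0 ?(ltW Ck)// subr_le0 /q lamk lerD2r.
by rewrite ler_wpM2r ?invr_ge0 ?m_nincr ?lcm_slope_ge0 ?k0// ltnW.
Qed.

(** Where [Y] rises, [g k] is that rise times the deficit in [ln x <= x - 1] at
    [x = m k.+1 / lam k.+1]. Where it does not, [g k] is 0 if [lam k.+1 > 0], and
    [m k.+1 * (W k.+1 - W k)] if [lam k.+1 = 0]. *)
Let g_ge0 k : (k < n)%N -> 0 <= g k.
Proof.
move=> kn; rewrite /g CS// /q.
have mk := @m_ge0 k.+1 kn; have Wk := W_incr kn.
have := Y_ndecr kn; rewrite le_eqVlt => /orP[/eqP Yk|Yk].
  rewrite Yk subrr !mul0r !sub0r.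
  have := @lcm_slope_ge0 k.+1 kn; rewrite le_eqVlt => /orP[/eqP lamk|lamk].
    rewrite -lamk mul0r oppr0 mulr0; nra.
  rewrite le_eqVlt; apply/orP; left; apply/eqP.
  by field; rewrite gt_eqF.
have mk0 := @m_gt0 k.+1 kn Yk; have lk0 := @lcm_slope_gt0 k.+1 kn Yk.
have [lnle _] := ln_leB1_eq (divr_gt0 mk0 lk0).
rewrite ln_div// in lnle.
have : 0 <= (Y k.+1 - Y k) *
    (m k.+1 / lam k.+1 - 1 - (ln (m k.+1) - ln (lam k.+1))).
  by rewrite mulr_ge0// subr_ge0// ltW.
move=> /le_trans; apply; rewrite le_eqVlt; apply/orP; left; apply/eqP.
by field; rewrite gt_eqF.
Qed.

(* Summation by parts against C = Y - M; e k is the deficit at the vertex k,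
   g k that of the concavity inequality ln x <= x - 1. *)
Let loglik_deficit :
  weighted_loglik lam - weighted_loglik m = \sum_(k < n) (g k + e k).
Proof.
have Cn : C n = 0.
  case: (posnP n) => [->//|n0].
  apply/eqP; rewrite eq_le C_le0//= leNgt; apply/negP => Cn.
  by have [] := C_lt0 _ Cn; [rewrite n0 /=|rewrite ltnn].
(* The boundary terms of the summation by parts vanish because [C 0 = C n = 0]. *)
have tele : \sum_(k < n) (q k.+1 * C k.+1 - q k * C k) = 0.
  rewrite -(big_mkord xpredT (fun k => q k.+1 * C k.+1 - q k * C k)).
  by rewrite (telescope_sumr (fun k => q k * C k))// Cn C0 !mulr0 subrr.
rewrite -sumrB -[LHS]addr0 -[X in _ + X = _]tele -big_split/=; apply: eq_bigr => k _.
by rewrite /g /e; ring.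
Qed.

Lemma weighted_loglik_le : weighted_loglik m <= weighted_loglik lam.
Proof.
rewrite -subr_ge0 loglik_deficit sumr_ge0// => k _.
by rewrite addr_ge0 ?g_ge0 ?e_ge0.
Qed.

(** Equality forces every [g k] and [e k] to vanish. Each edge is then settled by [g k = 0], or
    inherits its value from the next edge, whence a descending induction. *)
Lemma weighted_loglik_eq : weighted_loglik m = weighted_loglik lam ->
  forall k, (0 < k <= n)%N -> m k = lam k.
Proof.
move=> meq; have := loglik_deficit; rewrite meq subrr => /esym sum0.
have ge0 (i : 'I_n) : true -> 0 <= g i + e i.
  by move=> _; rewrite addr_ge0 ?g_ge0 ?e_ge0.
have ge0n k : (k < n)%N -> g k = 0 /\ e k = 0.
  move=> kn; have /eqP := psumr_eq0P ge0 sum0 (i := Ordinal kn) isT.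
  by rewrite paddr_eq0 ?g_ge0 ?e_ge0//= => /andP[/eqP -> /eqP ->].
have step k : (k < n)%N -> ((k.+1 < n)%N -> m k.+2 = lam k.+2) ->
    m k.+1 = lam k.+1.
  move=> kn mk2; have [gk _] := ge0n k kn; have Wk := W_incr kn.
  have := Y_ndecr kn; rewrite le_eqVlt => /orP[/eqP Yk|Yk]; last first.
    have mk0 := @m_gt0 k.+1 kn Yk; have lk0 := @lcm_slope_gt0 k.+1 kn Yk.
    have [_ lneq] := ln_leB1_eq (divr_gt0 mk0 lk0).
    apply/divr1_eq/lneq; rewrite ln_div//.
    have : (Y k.+1 - Y k) *
        (m k.+1 / lam k.+1 - 1 - (ln (m k.+1) - ln (lam k.+1))) = 0.
      by rewrite -gk /g CS// /q; field; rewrite gt_eqF.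
    move=> /eqP; rewrite mulf_eq0 subr_eq0 gt_eqF//= => /eqP; lra.
  have := @lcm_slope_ge0 k.+1 kn; rewrite le_eqVlt => /orP[/eqP lamk|lamk].
    move: gk; rewrite /g CS// -lamk Yk subrr !mul0r !sub0r oppr0 mulr0.
    rewrite subr0 add0r opprK => /eqP; rewrite mulf_eq0 subr_eq0 (gt_eqF Wk).
    by rewrite orbF => /eqP.
  (* The majorant rises over this edge while [Y] does not, so vertex [k.+1] is strictly below it,
     and [e k.+1 = 0] gives [q k.+2 = q k.+1]. *)
  have Ck1 : C k.+1 < 0.
    have := CS kn; have := C_le0 (ltnW kn); rewrite Yk subrr.
    have : 0 < lam k.+1 * (W k.+1 - W k) by rewrite mulr_gt0 ?subr_gt0.
    lra.
  have [kn1 lamk1] := @C_lt0 k.+1 kn Ck1.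
  have [_ /eqP] := ge0n k.+1 kn1.
  rewrite /e mulf_eq0 (lt_eqF Ck1)/= subr_eq0 /q mk2// lamk1 divff ?(gt_eqF lamk)//.
  by rewrite subrr eq_sym subr_eq0 => /eqP/divr1_eq.
suff H j k : (n - k <= j)%N -> (k < n)%N -> m k.+1 = lam k.+1.
  by case=> [//|k] kn; exact: H (leqnn _) kn.
elim: j k => [|j IHj] k nkj kn; first by lia.
by apply: step => // kn1; apply: IHj => //; lia.
Qed.

End weighted_likelihood.

(** * The cumulative sum diagram of the data *)

Lemma integral_empirical (d : measure_display) (O : measurableType d)
    (R : realType) (n : nat) (X : 'I_n -> O) (f : O -> R) :
  measurable_fun setT f -> (forall x, 0 <= f x) ->
  \int[empirical R X]_x f x = n%:R^-1 * \sum_(i < n) f (X i).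
Proof.
move=> mf f0.
(* [msum] wants measures indexed by [nat]; indices out of range get the zero measure. *)
pose m k : {measure set O -> \bar R} :=
  if insub k is Some i then \d_(X (i : 'I_n)) else mzero.
have mE A : empirical R X A = mscale (n%:R^-1)%:nng (msum m n) A.
  rewrite /empirical /mscale /msum; congr (_ * _)%E.
  by apply: eq_bigr => i _; rewrite /m valK.
have mEf : measurable_fun setT (fun x => (f x)%:E) by exact/measurable_EFinP.
rewrite /Rintegral (eq_measure_integral (mscale (n%:R^-1)%:nng (msum m n)));
  last by move=> A _ _; exact: mE.
rewrite ge0_integral_mscale//= ?ge0_integral_measure_sum//; last 2 first.
- by move=> x _; rewrite lee_fin.
- by move=> x _; rewrite lee_fin.
rewrite (eq_bigr (fun i : 'I_n => (f (X i))%:E)) ?sumEFin// => i _.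
by rewrite /m valK integral_dirac// diracT mul1e.
Qed.

(** The length of [[0, min u x]]. The outer maximum covers [u < 0], needed to rewrite under the
    integral over all observations. *)
Lemma Rintegral_le_itv (R : realType) (u x : R) : 0 <= x ->
  \int[@lebesgue_measure R]_(s in `[0, x]) (s <= u)%R%:R =
  Num.max 0 (Num.min u x).
Proof.
move=> x0; rewrite /Rintegral.
transitivity (fine (\int[@lebesgue_measure R]_(s in `[0%R, x])
    (\1_([set` `]-oo, u]] : set R) s)%:E)).
  congr fine; apply: eq_integral => s _.
  by rewrite indicE mem_setE in_itv.
rewrite integral_indic//.
have -> : [set` `]-oo, u]] `&` [set` `[0, x]] =
    [set` `[0, Num.min u x]] :> set R.
  apply/seteqP; split=> s /=; rewrite !in_itv/= le_min.
    by move=> [-> /andP[-> ->]].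
  by move=> /and3P[-> -> ->].
transitivity (fine (@lebesgue_measure R [set` `[0, Num.min u x]])) => //.
rewrite lebesgue_measure_itv/= lte_fin oppr0 -EFinD addr0.
by rewrite /Num.max; case: ifP.
Qed.

Section cusum_integrals.
Context (R : realType) (p n : nat).
Context (T : 'I_n -> R) (Delta : 'I_n -> bool) (Z : 'I_n -> p.-tuple R).

Lemma measurable_dotp (beta : p.-tuple R) :
  measurable_fun setT (fun z : p.-tuple R => dotp beta z).
Proof.
rewrite /dotp; apply: measurable_sum => k.
by apply: measurable_funM => //; exact: measurable_tnth.
Qed.

Lemma WnE (beta : p.-tuple R) (x : R) : (forall i, 0 < T i) -> 0 <= x ->
  Wn T Delta Z beta x =
  n%:R^-1 * \sum_(i < n) expR (dotp beta (Z i)) * Num.min (T i) x.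
Proof.
move=> T_gt0 x0; rewrite /Wn.
under [X in Rintegral _ _ X]eq_fun do rewrite (Rintegral_le_itv _ x0).
rewrite integral_empirical//=.
- congr (_ * _); apply: eq_bigr => i _; congr (_ * _).
  by apply/max_idPr; rewrite le_min ltW.
- apply: measurable_funM.
    apply: measurableT_comp => //; apply: measurableT_comp => //.
    exact: measurable_dotp.
  apply: measurable_maxr => //; apply: measurable_minr => //.
  exact: measurableT_comp.
- by move=> o; rewrite mulr_ge0 ?expR_ge0// le_max lexx.
Qed.

Lemma YnE (x : R) :
  Yn T Delta Z x = n%:R^-1 * \sum_(i < n) (Delta i)%:R * (T i <= x)%R%:R.
Proof.
rewrite /Yn integral_empirical//=.
apply: measurable_funM.
  apply: (@measurableT_comp _ _ _ _ _ _ (fun b : bool => b%:R : R)) => //.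
  exact: measurableT_comp.
apply: (@measurableT_comp _ _ _ _ _ _ (fun b : bool => b%:R : R)) => //.
by apply: measurable_fun_ler => //; exact: measurableT_comp.
Qed.

End cusum_integrals.

(** * Loglikelihood of a nonincreasing hazard *)

Section cumulative_hazard.
Context (R : realType) (lam : R -> R).
Hypothesis lam_hazard : nonincreasing_hazard lam.

Let lam_ge0 x : 0 < x -> 0 <= lam x. Proof. exact: lam_hazard.1. Qed.

Let lam_ni x y : 0 < x -> x <= y -> lam y <= lam x.
Proof. exact: lam_hazard.2. Qed.

(** By monotonicity the preimages of the rays [[r, +oo[], which generate the Borel sets, are
    intervals. *)
Lemma measurable_hazard : measurable_fun (`]0, +oo[ : set R) lam.
Proof.
move=> m0; apply: (measurability (@RGenCInfty.G R)) => //; last move=> /= _ [_] [r] -> <-.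
  exact: RGenCInfty.measurableE.
apply: is_interval_measurable => s t/=.
rewrite !in_itv/= !andbT => -[s0 _] [t0 rt] u /andP[su ut].
have u0 := lt_le_trans s0 su.
by rewrite !in_itv/= !andbT u0 (le_trans rt)// lam_ni.
Qed.

Let mlam a b : 0 <= a -> measurable_fun (`]a, b] : set R) (fun u => (lam u)%:E).
Proof.
move=> a0; apply/measurable_EFinP; apply: measurable_funS measurable_hazard => //.
by move=> x /=; rewrite !in_itv/= andbT => /andP[/(le_lt_trans a0)].
Qed.

Lemma cumhaz0 : cumhaz lam 0 = 0%E.
Proof. by rewrite /cumhaz set_itvoc0 integral_set0. Qed.

Lemma cumhaz_split (a b : R) : 0 <= a -> a <= b -> cumhaz lam b =
  (cumhaz lam a + \int[@lebesgue_measure R]_(u in `]a, b]) (lam u)%:E)%E.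
Proof.
move=> a0 ab; rewrite /cumhaz.
have -> : [set` `]0, b]] = [set` `]0, a]] `|` [set` `]a, b]] :> set R.
  by rewrite -itv_bndbnd_setU// bnd_simp.
rewrite ge0_integral_setU//.
- rewrite -itv_bndbnd_setU ?bnd_simp//; exact: mlam.
- move=> x /= []; rewrite in_itv/= => /andP[x0 _]; rewrite lee_fin lam_ge0//.
  exact: le_lt_trans x0.
- apply/disj_setPS => x [] /=; rewrite !in_itv/= => /andP[_ xa] /andP[ax _].
  by move: (le_lt_trans xa ax); rewrite ltxx.
Qed.

Let integral_itv_cst (c a b : R) : a <= b ->
  (\int[@lebesgue_measure R]_(u in `]a, b]) c%:E = (c * (b - a))%:E)%E.
Proof.
move=> ab.
transitivity (c%:E * @lebesgue_measure R [set` `]a, b]])%E.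
  exact: integral_cst.
have -> : @lebesgue_measure R [set` `]a, b]] = (b - a)%:E.
  rewrite lebesgue_measure_itv/= lte_fin; case: ltP => // ba.
  by rewrite [a](@le_anti _ _ a b) ?ab// subrr.
by rewrite EFinM.
Qed.

Lemma cumhaz_ge (a b : R) : 0 <= a -> a <= b ->
  (cumhaz lam a + (lam b * (b - a))%:E <= cumhaz lam b)%E.
Proof.
move=> a0 ab; rewrite [leRHS](cumhaz_split a0)// leeD2l//.
(* Monotonicity needs positive points; [b = 0] can occur only with [a = b]. *)
have [->|ab'] := eqVneq a b.
  by rewrite subrr mulr0 set_itvoc0 integral_set0.
have b0 : 0 < b by rewrite (le_lt_trans a0)// lt_neqAle ab' ab.
rewrite -integral_itv_cst//; apply: ge0_le_integral => //.
- by move=> x _; rewrite lee_fin lam_ge0.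
- exact: mlam.
- move=> x /=; rewrite in_itv/= => /andP[ax xb].
  by rewrite lee_fin lam_ni// (le_lt_trans a0).
Qed.

Lemma cumhaz_cst (c a b : R) : 0 <= a -> a <= b ->
  (forall x, a < x <= b -> lam x = c) ->
  cumhaz lam b = (cumhaz lam a + (c * (b - a))%:E)%E.
Proof.
move=> a0 ab lamc; rewrite (cumhaz_split a0)//; congr (_ + _)%E.
rewrite -integral_itv_cst//; apply: eq_integral => x.
by rewrite inE/= in_itv/= => /lamc ->.
Qed.

Context (n : nat) (tau : nat -> R).
Hypothesis tau0 : tau 0%N = 0.
Hypothesis tau_incr : forall k, (k < n)%N -> tau k < tau k.+1.

(** The cumulative hazard at [tau k] of the left-continuous step function with value [m l] on []tau
    l.-1, tau l]]. *)
Definition step_cumhaz (m : nat -> R) (k : nat) : R :=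
  \sum_(l < k) m l.+1 * (tau l.+1 - tau l).

Let tau_ge0 k : (k <= n)%N -> 0 <= tau k.
Proof.
elim: k => [|k IHk] kn; first by rewrite tau0.
by rewrite (le_trans (IHk (ltnW kn)))// ltW// tau_incr.
Qed.

Let step_cumhazS m k :
  step_cumhaz m k.+1 = step_cumhaz m k + m k.+1 * (tau k.+1 - tau k).
Proof. by rewrite /step_cumhaz big_ord_recr. Qed.

Lemma step_cumhaz_le k : (k <= n)%N ->
  ((step_cumhaz (lam \o tau) k)%:E <= cumhaz lam (tau k))%E.
Proof.
elim: k => [|k IHk] kn; first by rewrite /step_cumhaz big_ord0 tau0 cumhaz0.
rewrite step_cumhazS EFinD (le_trans _ (cumhaz_ge (tau_ge0 (ltnW kn)) _))//.
  by rewrite leeD2r// IHk// ltnW.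
by rewrite ltW// tau_incr.
Qed.

Lemma cumhaz_step (m : nat -> R) :
  (forall k, (0 < k <= n)%N ->
     forall x, tau k.-1 < x <= tau k -> lam x = m k) ->
  forall k, (k <= n)%N -> cumhaz lam (tau k) = (step_cumhaz m k)%:E.
Proof.
move=> lamm; elim=> [|k IHk] kn; first by rewrite /step_cumhaz big_ord0 tau0 cumhaz0.
rewrite step_cumhazS EFinD -IHk 1?ltnW//.
apply: cumhaz_cst; rewrite ?tau_ge0 ?(ltnW kn)//; first by rewrite ltW// tau_incr.
exact: (lamm k.+1).
Qed.

(** Split the interval at [x]: the hazard is at least [lam x] before [x] and at least its right end
    value after it, so [lam x] above that end value would make the integral too large. *)
Lemma cumhaz_step_inv :
  (forall k, (k <= n)%N ->
     cumhaz lam (tau k) = (step_cumhaz (lam \o tau) k)%:E) ->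
  forall k, (0 < k <= n)%N ->
    forall x, tau k.-1 < x <= tau k -> lam x = lam (tau k).
Proof.
move=> lamtau [//|k] /= kn x /andP[kx xk].
have k0 := tau_ge0 (ltnW kn); have x0 := le_lt_trans k0 kx.
apply/eqP; rewrite eq_le [X in _ && X]lam_ni// andbT.
have := cumhaz_ge k0 (ltW kx); have := cumhaz_ge (ltW x0) xk.
rewrite (lamtau _ kn) (lamtau _ (ltnW kn)) step_cumhazS /=.
case: (cumhaz lam x) => [c| |] //=; rewrite -!EFinD !lee_fin => h1 h2.
rewrite -(ler_pM2r (_ : 0 < x - tau k)) ?subr_gt0//; lra.
Qed.

End cumulative_hazard.

(** * Ordered data: increments of the diagram and loglikelihood of step hazards *)

Section order_statistics.
Context (R : realType) (p n : nat) (T : 'I_n -> R) (Delta : 'I_n -> bool)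
        (Z : 'I_n -> p.-tuple R) (beta : p.-tuple R).
Hypothesis n_gt0 : (0 < n)%N.
Hypothesis T_gt0 : forall i, 0 < T i.
Hypothesis T_inj : injective T.

Local Notation tau := (Tord T).
Local Notation D k := (Dord T Delta k).
Local Notation z k := (Zord T Z k).
Local Notation risk k := (expR (dotp beta (Zord T Z k))).

Let r (k : nat) : 'I_n := nth (Ordinal n_gt0) (ranking T) k.

Let size_ranking : size (ranking T) = n.
Proof. by rewrite /ranking size_sort size_enum_ord. Qed.

Let TordS k : (k < n)%N -> tau k.+1 = T (r k).
Proof. by move=> kn; rewrite /Tord /= (nth_map (Ordinal n_gt0)) ?size_ranking. Qed.

Let DordS k : (k < n)%N -> D k.+1 = Delta (r k).
Proof. by move=> kn; rewrite /Dord /= (nth_map (Ordinal n_gt0)) ?size_ranking. Qed.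

Let ZordS k : (k < n)%N -> z k.+1 = Z (r k).
Proof. by move=> kn; rewrite /Zord /= (nth_map (Ordinal n_gt0)) ?size_ranking. Qed.

Let sum_ranking (V : nmodType) (f : 'I_n -> V) :
  \sum_(i < n) f i = \sum_(k < n) f (r k).
Proof.
transitivity (\sum_(i <- ranking T) f i); last first.
  by rewrite (big_nth (Ordinal n_gt0)) size_ranking big_mkord.
rewrite -big_enum; apply: perm_big.
by rewrite perm_sym /ranking perm_sort.
Qed.

Lemma Tord0 : tau 0 = 0. Proof. by []. Qed.

Lemma Tord_incr k : (k < n)%N -> tau k < tau k.+1.
Proof.
case: k => [|k] kn; first by rewrite TordS.
rewrite !TordS// ?(ltnW kn)// lt_neqAle; apply/andP; split.
  apply/negP => /eqP/T_inj/eqP; rewrite nth_uniq ?size_ranking ?(ltnW kn)//.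
    by rewrite ltn_eqF.
  by rewrite sort_uniq enum_uniq.
have trT : transitive (fun i j : 'I_n => T i <= T j).
  by move=> a b c; exact: le_trans.
have totT : total (fun i j : 'I_n => T i <= T j) by move=> a b; exact: le_total.
have := sort_sorted totT (enum 'I_n); rewrite -/(ranking T) => sT.
have reflT : reflexive (fun i j : 'I_n => T i <= T j) by move=> a; exact: lexx.
apply: (sorted_leq_nth trT reflT (Ordinal n_gt0) sT) => //.
- by rewrite inE size_ranking ltnW.
- by rewrite inE size_ranking.
Qed.

Let tau_lt := ltn_incr_lt Tord_incr.

Let tau_le i j : (i <= j <= n)%N -> tau i <= tau j.
Proof.
by rewrite leq_eqVlt => /andP[/orP[/eqP->//|ij] jn]; rewrite ltW// tau_lt.
Qed.

Lemma Tord_ge0 k : (k <= n)%N -> 0 <= tau k.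
Proof. by move=> kn; rewrite -Tord0 tau_le. Qed.

Lemma Tord_gt0 k : (0 < k <= n)%N -> 0 < tau k.
Proof. by move=> /andP[k0 kn]; rewrite -Tord0 tau_lt. Qed.

Let W k := Wn T Delta Z beta (tau k).
Let Y k := Yn T Delta Z (tau k).

Lemma cusumE k : cusum T Delta Z beta k = (W k, Y k).
Proof.
case: k => //=; rewrite /W /Y WnE// YnE Tord0 !big1 ?mulr0//= => i _.
  by rewrite leNgt T_gt0 mulr0.
by rewrite min_r ?mulr0// ltW.
Qed.

(** Only the observation of rank [k.+1] is counted at [tau k.+1] but not at [tau k]. *)
Lemma Yn_TordS k : (k < n)%N -> n%:R * (Y k.+1 - Y k) = (D k.+1)%:R.
Proof.
move=> kn; rewrite /Y !YnE -mulrBr mulVKf ?pnatr_eq0 ?gtn_eqF// -sumrB.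
rewrite sum_ranking (bigD1 (Ordinal kn))//= big1 ?addr0; last first.
  move=> l; rewrite -val_eqE/= => lk; rewrite -TordS//.
  case: (ltngtP l k) lk => // lk _.
    by rewrite !tau_le ?subrr//; lia.
  by rewrite !leNgt !tau_lt ?subrr// ltnS ltnW.
by rewrite -TordS// -DordS// lexx leNgt Tord_incr//= mulr1 mulr0 subr0.
Qed.

(** Truncating a follow-up time at [tau k.+1] instead of [tau k] adds the full gap for ranks above
    [k] and nothing for the others. *)
Lemma Wn_TordS k : (k < n)%N -> n%:R * (W k.+1 - W k) =
  (tau k.+1 - tau k) * \sum_(k.+1 <= l < n.+1) risk l.
Proof.
move=> kn; rewrite /W !WnE ?Tord_ge0 ?(ltnW kn)//.
rewrite -mulrBr mulVKf ?pnatr_eq0 ?gtn_eqF// -sumrB sum_ranking.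
rewrite big_add1 big_geq_mkord mulr_sumr [RHS]big_mkcond/=.
apply: eq_bigr => l _; rewrite -TordS// -ZordS//.
have ln := ltn_ord l; case: leqP => kl.
  by rewrite !min_r ?tau_le//; first [ring|lia].
rewrite !min_l ?subrr// tau_le//; lia.
Qed.

Lemma Yn_Tord_incr k : (k < n)%N -> Y k <= Y k.+1.
Proof.
move=> kn; rewrite -subr_ge0 -(pmulr_rge0 _ (_ : 0 < n%:R)) ?ltr0n//.
by rewrite Yn_TordS.
Qed.

Lemma Wn_Tord_incr k : (k < n)%N -> W k < W k.+1.
Proof.
move=> kn; rewrite -subr_gt0 -(pmulr_rgt0 _ (_ : 0 < n%:R)) ?ltr0n//.
rewrite Wn_TordS// mulr_gt0 ?subr_gt0 ?Tord_incr//.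
by rewrite big_ltn// ltr_wpDr ?expR_gt0// sumr_ge0.
Qed.

(** Both sums telescope and the factors [n] cancel, leaving the slope of a chord of the diagram. *)
Lemma block_ratioE s t : (0 < s <= t)%N -> (t <= n)%N ->
  block_ratio T Delta Z beta s t = (Y t - Y s.-1) / (W t - W s.-1).
Proof.
case: s => // s st tn; rewrite /block_ratio !big_add1/=.
rewrite (eq_big_nat _ _ (F2 := fun j => n%:R * (Y j.+1 - Y j))); last first.
  by move=> j jst; rewrite Yn_TordS//; lia.
rewrite [X in _ / X](eq_big_nat _ _ (F2 := fun j => n%:R * (W j.+1 - W j)));
  last by move=> j jst; rewrite Wn_TordS//; lia.
rewrite -!mulr_sumr !telescope_sumr ?(ltnW st)//.
by rewrite -mulf_div divff ?mul1r// pnatr_eq0 gtn_eqF.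
Qed.

Let ratio_denom_gt0 s t : (0 < s <= t)%N -> (t <= n)%N -> 0 < W t - W s.-1.
Proof.
move=> st tn; rewrite subr_gt0 (ltn_incr_lt Wn_Tord_incr)//; lia.
Qed.

(** A single [t] makes every inner maximum at least [lam i]; a single [s] keeps all its ratios at
    most [lam i]. *)
Lemma lcm_slope_minmax (lam M : nat -> R) : lcm_vertices 0 n W Y lam M ->
  forall i, (0 < i <= n)%N -> lam i = minmax_ratio T Delta Z beta i.
Proof.
move=> lamM i in_; apply/eqP; rewrite eq_le; apply/andP; split.
  have [t itn lamt] := lcm_chord_le_slope Wn_Tord_incr lamM in_.
  have ge s : (0 < s <= i)%N -> lam i <= max_ratio T Delta Z beta i s.
    move=> si; apply: (@bigmax_sup_seq _ _ _ _ _ t) => //.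
      by rewrite mem_index_iota ltnS.
    have st : (0 < s <= t)%N by lia.
    have tn : (t <= n)%N by lia.
    by rewrite block_ratioE// ler_pdivlMr ?ratio_denom_gt0 ?lamt.
  rewrite /minmax_ratio big_nat; apply: le_bigmin.
    by apply: ge; rewrite leqnn andbT; case/andP: in_.
  by move=> s; rewrite ltnS => /ge.
have [s si lams] := lcm_slope_le_chord Wn_Tord_incr lamM in_.
rewrite /minmax_ratio.
apply: (@bigmin_inf_seq _ _ _ _ _ s) => //.
  by rewrite mem_index_iota ltnS.
have le t : (i <= t <= n)%N -> block_ratio T Delta Z beta s t <= lam i.
  move=> itn; have st : (0 < s <= t)%N by lia.
  have tn : (t <= n)%N by lia.
  by rewrite block_ratioE// ler_pdivrMr ?ratio_denom_gt0 ?lams.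
rewrite /max_ratio big_nat; apply: bigmax_le.
  by apply: le; rewrite leqnn; case/andP: in_.
by move=> t; rewrite ltnS => /le.
Qed.

Definition step_loglik (m : nat -> R) : R :=
  \sum_(k < n) ((D k.+1)%:R * ln (m k.+1) + (D k.+1)%:R * dotp beta (z k.+1)
                - risk k.+1 * step_cumhaz tau m k.+1).

(** Exchanging the double sum weights each increment of the cumulative hazard by the total risk of
    the ranks from [l] on, which [Wn_TordS] identifies. *)
Lemma step_loglikE (m : nat -> R) : step_loglik m =
  \sum_(k < n) (D k.+1)%:R * dotp beta (z k.+1)
  + n%:R * weighted_loglik n W Y m.
Proof.
rewrite /step_loglik /weighted_loglik mulr_sumr.
under [X in _ = _ + X]eq_bigr => k _ do
  rewrite mulrBr mulrA Yn_TordS// mulrCA Wn_TordS//.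
rewrite !sumrB !big_split/= addrA; congr (_ - _).
  exact: addrC.
under eq_bigr => k _.
  rewrite mulr_sumr (big_ord_widen n (fun l => risk k.+1 *
    (m l.+1 * (tau l.+1 - tau l)))) => [|//].
  over.
rewrite (exchange_big_dep xpredT)//=; apply: eq_bigr => l _.
rewrite big_add1 big_geq_mkord !mulr_sumr.
by apply: eq_big => [k|k _]; [rewrite ltnS|ring].
Qed.

Section loglik_bound.
Context (lam : R -> R).
Hypothesis lam_hazard : nonincreasing_hazard lam.
Let m k := lam (tau k).

Let term k : \bar R :=
  ((D k.+1)%:R%:E * lne (m k.+1)%:E + ((D k.+1)%:R * dotp beta (z k.+1))%:E
   - (risk k.+1)%:E * cumhaz lam (tau k.+1))%E.

Let loglikE : loglik T Delta Z beta lam = (\sum_(k < n) term k)%E.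
Proof.
rewrite /loglik sum_ranking; apply: eq_bigr => k _.
by rewrite /term /m -TordS// -DordS// -ZordS.
Qed.

Lemma loglik_Ny k : (0 < k <= n)%N -> D k -> m k = 0 ->
  loglik T Delta Z beta lam = -oo%E.
Proof.
case: k => // k kn Dk mk; rewrite loglikE; apply/esum_eqNyP.
exists (Ordinal kn); split => //.
by rewrite /term/= Dk mk lexx mul1e.
Qed.

Hypothesis m_gt0 : forall k, (0 < k <= n)%N -> D k -> 0 < m k.

Let termE k : (k < n)%N -> term k =
  (((D k.+1)%:R * ln (m k.+1) + (D k.+1)%:R * dotp beta (z k.+1))%:E
   - (risk k.+1)%:E * cumhaz lam (tau k.+1))%E.
Proof.
move=> kn; rewrite /term EFinD; congr (_ + _ - _)%E.
case: (boolP (D k.+1)) => Dk; last by rewrite mul0e mul0r.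
by rewrite mul1e mul1r lne_EFin// m_gt0.
Qed.

Let cumhaz_ge_step k : (k <= n)%N ->
  ((step_cumhaz tau m k)%:E <= cumhaz lam (tau k))%E.
Proof. exact: (step_cumhaz_le lam_hazard Tord0 Tord_incr). Qed.

(** The two sides differ only in the cumulative hazards, which enter with a negative sign. *)
Lemma loglik_le : (loglik T Delta Z beta lam <= (step_loglik m)%:E)%E.
Proof.
rewrite loglikE /step_loglik -sumEFin; apply: lee_sum => k _.
rewrite termE// EFinB leeD2l// leeN2 EFinM lee_pmul2l//.
  exact: cumhaz_ge_step.
by rewrite lte_fin expR_gt0.
Qed.

Lemma loglik_step :
  (forall k, (k <= n)%N -> cumhaz lam (tau k) = (step_cumhaz tau m k)%:E) ->
  loglik T Delta Z beta lam = (step_loglik m)%:E.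
Proof.
move=> lamm; rewrite loglikE /step_loglik -sumEFin; apply: eq_bigr => k _.
by rewrite termE// lamm.
Qed.

(** The gaps between the cumulative hazards are nonnegative and have positive weights, so a zero
    total makes each of them vanish. *)
Lemma loglik_step_inv : loglik T Delta Z beta lam = (step_loglik m)%:E ->
  forall k, (k <= n)%N -> cumhaz lam (tau k) = (step_cumhaz tau m k)%:E.
Proof.
move=> lamm.
(* An infinite cumulative hazard would make the loglikelihood [-oo]; finiteness allows computing in
   [R]. *)
have fin k : (k < n)%N -> cumhaz lam (tau k.+1) \is a fin_num.
  move=> kn; have := cumhaz_ge_step kn.
  case chz: (cumhaz lam (tau k.+1)) => [c| |]// _; exfalso.
  suff : loglik T Delta Z beta lam = -oo%E by rewrite lamm.
  rewrite loglikE; apply/esum_eqNyP; exists (Ordinal kn); split => //.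
  by rewrite termE//= chz gt0_muley ?lte_fin ?expR_gt0.
have gap0 (k : 'I_n) : true -> 0 <=
    risk k.+1 * (fine (cumhaz lam (tau k.+1)) - step_cumhaz tau m k.+1).
  move=> _; rewrite mulr_ge0 ?expR_ge0// subr_ge0 -lee_fin fineK ?fin//.
  exact: cumhaz_ge_step.
have sum0 : \sum_(k < n)
    risk k.+1 * (fine (cumhaz lam (tau k.+1)) - step_cumhaz tau m k.+1) = 0.
  move: lamm; rewrite loglikE.
  under eq_bigr => k _ do rewrite termE// -(fineK (fin _ (ltn_ord k))).
  rewrite sumEFin => -[] /eqP; rewrite -subr_eq0 /step_loglik -sumrB => /eqP s0.
  apply: oppr_inj; rewrite oppr0 -sumrN; apply: etrans s0.
  by apply: eq_bigr => k _; rewrite /=; ring.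
case=> [|k] kn; first by rewrite Tord0 cumhaz0 /step_cumhaz big_ord0.
have /eqP := psumr_eq0P gap0 sum0 (i := Ordinal kn) isT.
rewrite mulf_eq0 (gt_eqF (expR_gt0 _))/= subr_eq0 => /eqP <-.
by rewrite fineK ?fin.
Qed.

End loglik_bound.

End order_statistics.

(** * Characterization of the maximizers *)

Section npmle.
Context (R : realType) (p n : nat) (T : 'I_n -> R) (Delta : 'I_n -> bool)
        (Z : 'I_n -> p.-tuple R) (beta : p.-tuple R).
Hypothesis n_gt0 : (0 < n)%N.
Hypothesis T_gt0 : forall i, 0 < T i.
Hypothesis T_inj : injective T.

Local Notation tau := (Tord T).
Local Notation D k := (Dord T Delta k).

Let W k := Wn T Delta Z beta (tau k).
Let Y k := Yn T Delta Z (tau k).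

Context (lamhat M : nat -> R).
Hypothesis lamM : lcm_vertices 0 n W Y lamhat M.
Hypothesis M0 : M 0%N = Y 0%N.

Let W_incr := @Wn_Tord_incr R p n T Delta Z beta n_gt0 T_gt0 T_inj.
Let Y_ndecr := @Yn_Tord_incr R p n T Delta Z n_gt0 T_gt0 T_inj.
Let tau_incr := Tord_incr n_gt0 T_gt0 T_inj.

Let event_incr k : (0 < k <= n)%N -> (Y k.-1 < Y k) = D k.
Proof.
case: k => // k /= kn; have := Yn_TordS Delta Z n_gt0 T_gt0 T_inj kn.
have n0 : (0 : R) < n%:R by rewrite ltr0n.
rewrite -/(Y k) -/(Y k.+1) -subr_gt0 -(pmulr_rgt0 _ n0) => ->.
by rewrite ltr0n; case: (D k.+1).
Qed.

(** Values beyond [tau n] are left free, as the likelihood does not see them. *)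
Definition piecewise_lamhat (lam : R -> R) : Prop :=
  forall i, (1 <= i <= n)%N -> forall x, tau i.-1 < x <= tau i -> lam x = lamhat i.

(* As lamhat is nonincreasing, the maximum is attained at the smallest k with
   x <= tau k. *)
Definition step_hazard (x : R) : R :=
  \big[Num.max/0]_(1 <= k < n.+1 | x <= tau k) lamhat k.

Lemma step_hazard_nonincreasing : nonincreasing_hazard step_hazard.
Proof.
split=> [x _|x y _ xy]; first exact: bigmax_ge_id.
by apply: sub_bigmax => k; exact: le_trans.
Qed.

Lemma step_hazardE : piecewise_lamhat step_hazard.
Proof.
move=> i in_ x /andP[ix xi]; apply/eqP; rewrite eq_le; apply/andP; split.
  rewrite /step_hazard big_nat_cond; apply: bigmax_le.
    exact: (lcm_slope_ge0 W_incr Y_ndecr lamM).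
  move=> k /andP[/andP[k0 kn] xk]; apply: (lcm_nonincr lamM); first by case/andP: in_.
  rewrite ltnS in kn; rewrite kn andbT leqNgt; apply/negP => ki.
  have : tau k <= tau i.-1.
    have [->//|ki1] := eqVneq k i.-1; rewrite ltW// (ltn_incr_lt tau_incr)//; lia.
  by rewrite leNgt (lt_le_trans ix).
by apply: le_bigmax_seq => //; rewrite mem_index_iota ltnS.
Qed.

Let step_loglik_congr (m m' : nat -> R) :
  (forall k, (0 < k <= n)%N -> m k = m' k) ->
  step_loglik T Delta Z beta m = step_loglik T Delta Z beta m'.
Proof.
move=> mm'; rewrite !step_loglikE//; congr (_ + _ * _).
by apply: eq_bigr => k _; rewrite mm' ?ltn_ord.
Qed.

Let optimum := step_loglik T Delta Z beta lamhat.

Let piecewise_Tord lam : piecewise_lamhat lam ->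
  forall k, (0 < k <= n)%N -> lam (tau k) = lamhat k.
Proof.
move=> lamE k kn; apply: lamE => //; rewrite lexx andbT.
by rewrite (ltn_incr_lt tau_incr)//; lia.
Qed.

Lemma loglik_piecewise lam : nonincreasing_hazard lam -> piecewise_lamhat lam ->
  loglik T Delta Z beta lam = optimum%:E.
Proof.
move=> lam_haz lamE; have lamtau := piecewise_Tord lamE.
rewrite loglik_step//.
- by congr EFin; apply: step_loglik_congr.
- move=> k kn Dk; rewrite lamtau//.
  by apply: (lcm_slope_gt0 W_incr Y_ndecr lamM) => //; rewrite event_incr.
- move=> k kn; rewrite (cumhaz_step lam_haz (Tord0 T) tau_incr lamE)//.
  congr EFin; apply: eq_bigr => l _; rewrite /= lamtau//.
  exact: leq_trans (ltn_ord l) kn.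
Qed.

Let step_loglik_le (m : nat -> R) : (forall k, (0 < k <= n)%N -> 0 <= m k) ->
  (forall k, (0 < k <= n)%N -> D k -> 0 < m k) ->
  (forall k, (0 < k < n)%N -> m k.+1 <= m k) ->
  step_loglik T Delta Z beta m <= optimum /\
  (step_loglik T Delta Z beta m = optimum ->
   forall k, (0 < k <= n)%N -> m k = lamhat k).
Proof.
move=> m0 mD m_ni.
have mY k : (0 < k <= n)%N -> Y k.-1 < Y k -> 0 < m k.
  by move=> kn; rewrite event_incr//; exact: mD.
rewrite /optimum !step_loglikE//; split.
  rewrite lerD2l ler_wpM2l ?ler0n//.
  exact: (weighted_loglik_le W_incr Y_ndecr lamM M0 m0 mY m_ni).
move=> /addrI/mulfI meq.
apply: (weighted_loglik_eq W_incr Y_ndecr lamM M0 m0 mY m_ni); apply: meq.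
by rewrite pnatr_eq0 gtn_eqF.
Qed.

Section hazard.
Context (mu : R -> R).
Hypothesis mu_haz : nonincreasing_hazard mu.

Let mu_ge0 k : (0 < k <= n)%N -> 0 <= mu (tau k).
Proof. by move=> kn; apply: mu_haz.1; exact: Tord_gt0. Qed.

Let mu_ni k : (0 < k < n)%N -> mu (tau k.+1) <= mu (tau k).
Proof.
move=> kn; apply: mu_haz.2; last by rewrite ltW// tau_incr; lia.
by apply: Tord_gt0 => //; lia.
Qed.

(** A zero hazard at an uncensored time gives [-oo]; otherwise the comparison of real-valued
    loglikelihoods applies. *)
Let mu_dichotomy : loglik T Delta Z beta mu = -oo%E \/
  forall k, (0 < k <= n)%N -> D k -> 0 < mu (tau k).
Proof.
case: (pselect (exists2 k, (0 < k <= n)%N & D k /\ mu (tau k) = 0)).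
  by move=> [k kn [Dk muk]]; left; exact: (loglik_Ny Z beta n_gt0 (lam := mu) kn Dk muk).
move=> nmu; right => k kn Dk; rewrite lt_neqAle mu_ge0// andbT eq_sym.
by apply/eqP => muk; apply: nmu; exists k.
Qed.

Lemma loglik_le_optimum : (loglik T Delta Z beta mu <= optimum%:E)%E.
Proof.
have [->|muD] := mu_dichotomy; first exact: leNye.
have [le_opt _] := step_loglik_le mu_ge0 muD mu_ni.
by rewrite (le_trans (loglik_le Z beta n_gt0 T_gt0 T_inj mu_haz muD))// lee_fin.
Qed.

(** The chain from [optimum] through [loglik mu] and the step loglikelihood back to [optimum]
    collapses. One equality fixes [mu] at the follow-up times, the other makes it constant between
    them. *)
Lemma loglik_optimum_piecewise :
  (optimum%:E <= loglik T Delta Z beta mu)%E -> piecewise_lamhat mu.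
Proof.
have [->|muD] := mu_dichotomy; first by rewrite leeNy_eq.
move=> opt_le; have := loglik_le Z beta n_gt0 T_gt0 T_inj mu_haz muD => le_step.
have [step_opt step_eq] := step_loglik_le mu_ge0 muD mu_ni.
have stepE : step_loglik T Delta Z beta (fun k => mu (tau k)) = optimum.
  by apply/eqP; rewrite eq_le step_opt -lee_fin (le_trans opt_le).
have llE : loglik T Delta Z beta mu =
    (step_loglik T Delta Z beta (fun k => mu (tau k)))%:E.
  by apply/eqP; rewrite eq_le le_step stepE.
move=> i in_ x xi; rewrite -(step_eq stepE)//.
apply: (cumhaz_step_inv mu_haz (Tord0 T) tau_incr) => // k kn.
exact: (loglik_step_inv n_gt0 T_gt0 T_inj mu_haz muD llE).
Qed.

End hazard.

(** A maximizer does at least as well as [step_hazard], which attains [optimum]. *)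
Lemma is_npmleP lam : is_npmle T Delta Z beta lam <->
  nonincreasing_hazard lam /\ piecewise_lamhat lam.
Proof.
split=> [[lam_haz lam_max]|[lam_haz lamE]]; split=> //.
  apply: loglik_optimum_piecewise => //.
  rewrite -(loglik_piecewise step_hazard_nonincreasing step_hazardE).
  exact: lam_max step_hazard_nonincreasing.
by move=> mu mu_haz; rewrite (loglik_piecewise lam_haz lamE) loglik_le_optimum.
Qed.

End npmle.

Theorem lemma2 (R : realType) (p n : nat) (T : 'I_n -> R)
    (Delta : 'I_n -> bool) (Z : 'I_n -> p.-tuple R) (beta : p.-tuple R)
    (n_gt0 : (0 < n)%N) (T_gt0 : forall i, 0 < T i) (T_inj : injective T) :
  let P := cusum T Delta Z beta in
  exists (G : R -> R) (lamhat : nat -> R),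
    [/\ least_concave_majorant n P G,
        (forall i, (1 <= i <= n)%N ->
           is_left_derivative G (P i).1 (lamhat i)),
        (exists lam : R -> R, is_npmle T Delta Z beta lam),
        (forall lam : R -> R,
           is_npmle T Delta Z beta lam <->
           nonincreasing_hazard lam /\
           forall i, (1 <= i <= n)%N ->
             forall x, Tord T i.-1 < x <= Tord T i -> lam x = lamhat i) &
        forall i, (1 <= i <= n)%N ->
          lamhat i = minmax_ratio T Delta Z beta i].
Proof.
move=> P; pose W k := Wn T Delta Z beta (Tord T k).
pose Y k := Yn T Delta Z (Tord T k).
have W_incr : forall k, (k < n)%N -> W k < W k.+1.
  by move=> k kn; exact: Wn_Tord_incr.
have PE k : P k = (W k, Y k) by exact: cusumE.
have [W0 Y0] : W 0%N = 0 /\ Y 0%N = 0 by have [-> ->] := PE 0%N.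
have [lamhat [M [lamM M0]]] := @lcm_vertices_exists R n W Y W_incr.
exists (lcm_fun n W lamhat M), lamhat; split.
- exact: (lcm_fun_lcm W_incr lamM).
- by move=> i in_; rewrite PE; exact: (lcm_fun_left_derivative W_incr lamM).
- exists (step_hazard T lamhat).
  apply/(is_npmleP n_gt0 T_gt0 T_inj lamM M0); split.
    exact: step_hazard_nonincreasing.
  exact: (step_hazardE n_gt0 T_gt0 T_inj lamM).
- by move=> lam; exact: (is_npmleP n_gt0 T_gt0 T_inj lamM M0).
- exact: (lcm_slope_minmax n_gt0 T_gt0 T_inj lamM).
Qed.
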